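(* Let $n\ge2$ and $m>0$, and let $V$ be the Dunkl intertwining operator for the root system $A_{n-1}$ with root multiplicity $m$, represented as $Vf(X)=\int_{\mathfrak{a}_n}f(H)\,d\mu_X(H)$ with positive measures $\mu_X$. Then for every $X\in\mathfrak{a}_n$ the support of $\mu_X$ is $C(X)$.
   Context: $\mathfrak{a}_n\cong\mathbb{R}^n$ is the space of real diagonal $n\times n$ matrices $X=\mathrm{diag}[x_1,\dots,x_n]$; $S_n$ acts by permuting diagonal entries, and $C(X)$ is the convex hull of the orbit $S_n\cdot X$. Dunkl operators for $A_{n-1}$ with root multiplicity $m$: for $v\in\mathbb{R}^n$, $$T_v f(X)=\partial_vf(X)+\sum_{i<j}\frac m2\,(v_i-v_j)\,\frac{f(X)-f(s_{ij}X)}{x_i-x_j},$$ where $s_{ij}$ exchanges $x_i$ and $x_j$. The Dunkl intertwining operator $V$ is the linear operator on polynomials on $\mathfrak{a}_n$ characterized by $T_vV=V\partial_v$ for all $v$, $V(\mathcal{P}_d)=\mathcal{P}_d$ for all $d$ (where $\mathcal{P}_d$ is the space of homogeneous polynomials of degree $d$), and $V|_{\mathcal{P}_0}=\mathrm{id}$. For each $X$ there is a compactly supported positive measure $\mu_X$ on $\mathfrak{a}_n$ with $Vf(X)=\int f\,d\mu_X$ for all polynomials $f$ (known); this formula extends $V$ to smooth functions. *)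

(* Defs.v *)
From HB Require Import structures.
From mathcomp Require Import all_boot all_order all_algebra all_fingroup.
From mathcomp Require Import all_classical all_reals all_analysis.
(* The notations of mpoly clash with those of MathComp-Analysis. *)
From mathcomp Require Import -(notations) mpoly.

Set Implicit Arguments.
Unset Strict Implicit.
Unset Printing Implicit Defensive.

Import Order.TTheory GRing.Theory Num.Theory.
Import numFieldNormedType.Exports.

Local Open Scope classical_set_scope.
Local Open Scope ring_scope.

(* The diagonal matrix diag[x_1, ..., x_n] is encoded as the row vector of its
   entries; this is 'rV[R]_n with its Borel sigma-algebra. *)
Notation borel_rV R n := (g_sigma_algebraType (@open 'rV[R]_n)).

Definition measure_support {R : realType} {n : nat}
    (mu : {measure set (borel_rV R n) -> \bar R}) : set 'rV[R]_n :=
  [set x | forall U : set 'rV[R]_n, open U -> U x -> (0 < mu U)%E].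

Section Dunkl.
Context {R : realType} {n : nat}.
Implicit Types (p : mpoly n R) (X v : 'rV[R]_n) (i j : 'I_n).

Definition mvar i : mpoly n R := mpolyX R (mnm1 i).

Definition peval p X : R := meval (fun i => X ord0 i) p.

(* The polynomial (p - s_ij p) / (x_i - x_j): for i <> j it is the unique
   polynomial r with (x_i - x_j) r = p - s_ij p, and it exists by [divdiffP]. *)
Definition divdiff i j p : mpoly n R :=
  xget 0 [set r | (mvar i - mvar j) * r = p - msym (tperm i j) p].

Definition pderiv v p : mpoly n R := \sum_(i < n) v ord0 i *: mderiv i p.

Definition dunkl (m : R) v p : mpoly n R :=
  pderiv v p +
  \sum_(i < n) \sum_(j < n | (i < j)%N)
    (m / 2 * (v ord0 i - v ord0 j)) *: divdiff i j p.

(* Contains the zero polynomial for every d. *)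
Definition homog_polys (d : nat) : set (mpoly n R) :=
  [set p | p \is @ishomog1 n R d mdeg].

Definition dunkl_intertwining (m : R)
    (V : {linear mpoly n R -> mpoly n R}) : Prop :=
  [/\ forall v p, dunkl m v (V p) = V (pderiv v p),
      forall d, V @` homog_polys d = homog_polys d
    & forall p, homog_polys 0 p -> V p = p].

Definition orbit_hull X : set 'rV[R]_n :=
  smallest (@convex_set R 'rV[R]_n)
    (range (fun s : {perm 'I_n} => col_perm s X)).

Lemma msym_mvar (s : {perm 'I_n}) i : msym s (mvar i) = mvar (s i).
Proof. by rewrite /msym /mvar mmapX mmap1U. Qed.

Lemma divdiffP i j p :
  (mvar i - mvar j) * divdiff i j p = p - msym (tperm i j) p.
Proof.
pose Q (q : mpoly n R) :=
  exists r, (mvar i - mvar j) * r = q - msym (tperm i j) q.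
suff [r hr] : Q p by rewrite /divdiff; case: xgetP => [_ _ -> //|/(_ r)].
have Q1 : Q 1 by exists 0; rewrite rmorph1 subrr mulr0.
have QM x y : Q x -> Q y -> Q (x * y).
  move=> [q hq] [r hr]; exists (q * y + msym (tperm i j) x * r).
  by rewrite mulrDr mulrA hq mulrCA hr msymM mulrBl mulrBr addrA subrK.
have QX k : Q (mvar k).
  rewrite /Q msym_mvar; case: tpermP => [->|->|_ _].
  - by exists 1; rewrite mulr1.
  - by exists (-1); rewrite mulrN1 opprB.
  - by exists 0; rewrite subrr mulr0.
elim/mpolyind: p => [|c mm p _ _ [r hr]].
  by exists 0; rewrite msym0 mulr0 subr0.
have [q hq] : Q (mpolyX R mm).
  rewrite mpolyXE_id; elim/big_ind: _ => // k _.
  elim: (mm k) => [|e IHe]; first by rewrite expr0.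
  by rewrite exprS; apply: QM => //; exact: QX.
exists (c *: q + r); rewrite mulrDr hr -scalerAr hq msymD msymZ scalerBr.
by rewrite opprD addrACA.
Qed.

Lemma peval_msym (s : {perm 'I_n}) p X :
  peval (msym s p) X = peval p (col_perm s X).
Proof.
rewrite /peval; elim/mpolyind: p => [|c mm p _ _ IHp].
  by rewrite msym0 !meval0.
rewrite msymD msymZ !mevalD !mevalZ IHp; congr (_ * _ + _).
rewrite mpolyXE_id !rmorph_prod; apply: eq_bigr => k _.
by rewrite !rmorphXn /= [msym _ _]msym_mvar !mevalXU mxE.
Qed.

(* At regular points, [dunkl] is given by the usual difference quotients. *)
Lemma dunklE (m : R) v p X : (forall i j, i != j -> X ord0 i != X ord0 j) ->
  peval (dunkl m v p) X = peval (pderiv v p) X +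
    \sum_(i < n) \sum_(j < n | (i < j)%N)
      m / 2 * (v ord0 i - v ord0 j) *
      ((peval p X - peval p (col_perm (tperm i j) X)) / (X ord0 i - X ord0 j)).
Proof.
move=> regX; rewrite {1}/peval mevalD; congr (_ + _).
rewrite raddf_sum; apply: eq_bigr => i _ /=.
rewrite raddf_sum; apply: eq_bigr => j ltij /=.
rewrite mevalZ; congr (_ * _).
have Xij : X ord0 i - X ord0 j != 0.
  by rewrite subr_eq0 regX// neq_ltn ltij.
apply: (mulIf Xij); rewrite divfK// -peval_msym -[RHS]mevalB -divdiffP.
by rewrite mevalM mevalB !mevalXU mulrC.
Qed.

End Dunkl.

(* Main.v *)
Require Import Defs.
From HB Require Import structures.
From mathcomp Require Import all_boot all_order all_algebra all_fingroup.
From mathcomp Require Import all_classical all_reals all_analysis.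
From mathcomp Require Import measurable_realfun.
From mathcomp Require Import -(notations) mpoly.
From mathcomp Require Import ring lra.
From mathcomp Require polyrcf.
Import numFieldNormedType.Exports.

(* Write [L_x p = V p (x)], the integral of [p] against [mu_x]. The intertwining
   relation at [x] in the direction [x], together with the fact that [V]
   commutes with the Euler operator, gives
     L_x (<H - x, grad p>) + m/2 \sum_{i<j} (L_x p - L_{s_ij x} p) = 0.
   Upper bound: for [p] a power of an affine form [l], the maximum principle on
   the orbit gives [|L_x (l ^ d)| <= (max_orbit |l|) ^ d], so [mu_x] does not
   charge half-spaces missing the orbit; separation concludes.
   Lower bound: integrating along dilations about [x], the relation says that
   [mu_x] is an average of the contractions towards [x] of the measures
   [mu_{s_ij x}]. Hence the support at [x] contains all segments from [x] to the
   support at [s_ij x]. It follows that the support is the same at all points of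
   the orbit and is star-shaped about each of them; the star centers form a
   convex set, which therefore contains the hull of the orbit. *)

Set Implicit Arguments.
Unset Strict Implicit.
Unset Printing Implicit Defensive.

Import Order.TTheory GRing.Theory Num.Theory.

Local Open Scope classical_set_scope.
Local Open Scope ring_scope.

(** * The intertwining relation in the radial direction *)

Section Euler.
Context {R : realType} {n : nat}.
Implicit Types (p q : mpoly n R) (x : 'rV[R]_n).

Definition euler p : mpoly n R := \sum_(k < n) mvar k * mderiv k p.

(** The Euler operator recentred at [x]: the derivative of [p] along the vector field H - x. *)
Definition radial x p : mpoly n R :=
  \sum_(k < n) (mvar k - x ord0 k *: 1) * mderiv k p.

Lemma radialE x p : radial x p = euler p - pderiv x p.
Proof.
rewrite /radial /euler /pderiv -sumrB; apply: eq_bigr => k _.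
by rewrite mulrBl -scalerAl mul1r.
Qed.

Lemma eulerD p q : euler (p + q) = euler p + euler q.
Proof.
rewrite /euler -big_split; apply: eq_bigr => k _.
by rewrite mderivD mulrDr.
Qed.

Lemma eulerZ (c : R) p : euler (c *: p) = c *: euler p.
Proof.
rewrite /euler scaler_sumr; apply: eq_bigr => k _.
by rewrite mderivZ scalerAr.
Qed.

Lemma euler_sum (I : Type) (r : seq I) (F : I -> mpoly n R) :
  euler (\sum_(i <- r) F i) = \sum_(i <- r) euler (F i).
Proof.
elim/big_rec2: _ => [|i _ y _ <-]; last exact: eulerD.
by rewrite /euler big1// => k _; rewrite mderiv0 mulr0.
Qed.

Lemma eulerX (u : multinom n) : euler (mpolyX R u) = (mdeg u)%:R *: mpolyX R u.
Proof.
rewrite /euler mdegE natr_sum scaler_suml; apply: eq_bigr => k _.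
rewrite mderivX -scalerAr; have [->|uk] := eqVneq (u k) 0%N.
  by rewrite !scale0r.
congr (_ *: _); rewrite /mvar -mpolyXD; congr (mpolyX _ _).
apply/mnmP => i; rewrite mnmDE mnmBE mnm1E.
by case: eqP => [<-|_]; rewrite ?subn0// subnKC// lt0n.
Qed.

Lemma euler_homog d p : homog_polys d p -> euler p = d%:R *: p.
Proof.
move=> /dhomogP hp; rewrite [in LHS](mpolyE p) euler_sum.
rewrite [in RHS](mpolyE p) scaler_sumr; apply: eq_big_seq => u up.
by rewrite eulerZ eulerX (hp u up) scalerA mulrC -scalerA.
Qed.

(** Checked on monomials: [V] preserves the degree, and the Euler operator is multiplication by the
    degree. *)
Lemma euler_intertwining (V : {linear mpoly n R -> mpoly n R}) p :
  (forall d, V @` homog_polys d = homog_polys d) -> euler (V p) = V (euler p).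
Proof.
move=> Vhom; rewrite (mpolyE p) euler_sum !linear_sum euler_sum.
apply: eq_bigr => u _; rewrite eulerZ !linearZ_LR eulerZ eulerX linearZ_LR.
congr (_ *: _).
apply: euler_homog; rewrite -Vhom; exists (mpolyX R u) => //.
by rewrite /homog_polys /= dhomogX.
Qed.

Lemma peval_sum (I : Type) (r : seq I) (P : pred I) (F : I -> mpoly n R) x :
  peval (\sum_(i <- r | P i) F i) x = \sum_(i <- r | P i) peval (F i) x.
Proof. exact: raddf_sum. Qed.

Lemma peval_mvar k x : peval (mvar k) x = x ord0 k.
Proof. exact: mevalXU. Qed.

(** In the direction v = x the factor x_i - x_j cancels the denominator. Working with [divdiffP]
    instead of quotients covers the points with equal coordinates. *)
Lemma euler_dunkl (m : R) x p :
  peval (euler p) x + m / 2 * (\sum_(i < n) \sum_(j < n | (i < j)%N)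
      (peval p x - peval p (col_perm (tperm i j) x))) =
  peval (dunkl m x p) x.
Proof.
rewrite [RHS]/peval /dunkl mevalD; congr (_ + _).
  rewrite /euler /pderiv peval_sum raddf_sum; apply: eq_bigr => k _ /=.
  by rewrite mevalZ -(peval_mvar k) /peval mevalM.
rewrite raddf_sum mulr_sumr; apply: eq_bigr => i _ /=.
rewrite raddf_sum mulr_sumr; apply: eq_bigr => j _ /=.
rewrite mevalZ -peval_msym -[_ - _]mevalB -divdiffP mevalM mevalB.
by rewrite -![meval _ (mvar _)]/(peval _ _) !peval_mvar mulrA.
Qed.

(* Evaluate the intertwining relation at [x] in the direction [x]: there the
   difference quotients of the Dunkl operator lose their denominators. *)
Lemma radial_intertwining (m : R) (V : {linear mpoly n R -> mpoly n R}) p x :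
  dunkl_intertwining m V ->
  peval (V (radial x p)) x = - (m / 2 *
    \sum_(i < n) \sum_(j < n | (i < j)%N)
      (peval (V p) x - peval (V p) (col_perm (tperm i j) x))).
Proof.
case=> VT Vhom _; rewrite radialE linearB -VT -(euler_intertwining _ Vhom).
rewrite [peval (_ - _) _]mevalB -![meval _ _]/(peval _ _).
by rewrite -euler_dunkl opprD addNKr.
Qed.

End Euler.

(** * Supports and integrals of polynomials *)

Section Support.
Context {R : realType} {n : nat}.
Implicit Types (p q : mpoly n R) (x : 'rV[R]_n) (U : set 'rV[R]_n).

Lemma peval_continuous p : continuous (peval p).
Proof.
pose Q (q : mpoly n R) := continuous (peval q : 'rV[R]_n -> R).
have QC c : Q (mpolyC n c).
  rewrite /Q (_ : peval _ = fun=> c); first exact: cst_continuous.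
  by apply/funext => y; rewrite /peval mevalC.
have Q1 : Q 1 by rewrite -(mpolyC1 n); exact: QC.
have QM q r : Q q -> Q r -> Q (q * r).
  move=> cq cr x; have := continuousM (cq x) (cr x).
  by congr (continuous_at _ _); apply/funext => y; rewrite /peval mevalM.
have QD q r : Q q -> Q r -> Q (q + r).
  move=> cq cr x; have := continuousD (cq x) (cr x).
  by congr (continuous_at _ _); apply/funext => y; rewrite /peval mevalD.
have QX k : Q (mvar k).
  rewrite /Q (_ : peval _ = fun y : 'rV[R]_n => y ord0 k).
    exact: coord_continuous.
  by apply/funext => y; rewrite peval_mvar.
elim/mpolyind: p => [|c u p _ _ IHp].
  by rewrite -[0](mpolyC0 n); exact: QC.
apply: (QD) => //; rewrite -mul_mpolyC; apply: (QM); first exact: QC.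
rewrite mpolyXE_id; elim/big_ind: _ => [//||k _]; first exact: QM.
elim: (u k) => [|e IHe]; first by rewrite expr0.
by rewrite exprS; apply: QM => //; exact: QX.
Qed.

Lemma open_borel_rV U : open U -> measurable (U : set (borel_rV R n)).
Proof. by move=> oU; exact: sub_sigma_algebra. Qed.

Lemma peval_measurable p (D : set (borel_rV R n)) :
  measurable_fun D (EFin \o (peval p : borel_rV R n -> R)).
Proof.
apply/measurable_EFinP; apply: measurable_funTS.
apply: (measurability _ (RGenOpens.measurableE R)).
move=> _ [_ [a [b ->] <-]]; rewrite setTI; apply: open_borel_rV.
have /continuousP cp := @peval_continuous p.
exact/cp/interval_open.
Qed.

Context (mu : {measure set (borel_rV R n) -> \bar R}).

Lemma measure_support_closed : closed (measure_support mu).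
Proof.
rewrite -openC openE => x /= /existsNP[U /not_implyP[oU /not_implyP[Ux muU]]].
apply: filterS (open_nbhs_nbhs (conj oU Ux)) => y Uy Sy.
exact/muU/Sy.
Qed.

(** Second countability, in the form needed to reduce uncountable unions of null open sets to
    countable ones. *)
Lemma rat_ball_nbhs U x : open U -> U x ->
  exists (q : 'rV[rat]_n) (k : nat),
    let B := ball (map_mx ratr q : 'rV[R]_n) k.+1%:R^-1 in B x /\ B `<=` U.
Proof.
move=> oU Ux; have /nbhs_ballP[e /= e0 eU] := open_nbhs_nbhs (conj oU Ux).
have e20 : 0 < e / 2 by rewrite divr_gt0.
have [k] : exists k, k.+1%:R^-1 < e / 2.
  exists (Num.truncn (e / 2)^-1).
  by rewrite invf_plt ?posrE// truncnS_gt.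
move=> ke; have k0 : (0 : R) < k.+1%:R^-1 by rewrite invr_gt0.
have rP j : exists r : rat, `|ratr r - x ord0 j| < k.+1%:R^-1.
  have [|r] := @rat_in_itvoo _ (x ord0 j - k.+1%:R^-1) (x ord0 j + k.+1%:R^-1).
    by rewrite ltrBlDr -addrA ltrDl addr_gt0.
  by rewrite inE => /itvP h; exists r; rewrite ltr_distl !h.
have [r rx] := choice rP.
exists (\row_j r j), k => /=; set B := ball _ _.
have Bx : B x.
  by split=> // i j; rewrite ord1 !mxE /ball /= rx.
split=> // y By; apply: eU; rewrite (splitr e).
apply: (ball_triangle (y := map_mx ratr (\row_j r j) : 'rV[R]_n)).
  apply: ball_sym; apply: le_ball Bx; exact: ltW.
by apply: le_ball By; exact: ltW.
Qed.

(** Each point outside the support has a null neighbourhood, hence lies in a null ball of the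
    countable base. *)
Lemma measure_support_null : mu (~` measure_support mu) = 0%E.
Proof.
have mS : measurable (~` measure_support mu : set (borel_rV R n)).
  by apply: open_borel_rV; rewrite openC; exact: measure_support_closed.
apply/(negligibleP _ mS).
pose B (a : 'rV[rat]_n * nat) : set (borel_rV R n) :=
  ball (map_mx ratr a.1 : 'rV[R]_n) a.2.+1%:R^-1.
(* Enumeration of the null balls of the base; all other indices contribute the empty set. *)
pose F k : set (borel_rV R n) := if unpickle k is Some a then
  if `[< mu (B a) = 0%E >] then B a else set0 else set0.
have mB a : measurable (B a) by apply: open_borel_rV; exact: ball_open.
apply: (@negligibleS _ _ _ _ (\bigcup_k F k)); last first.
  apply: negligible_bigcup => k; rewrite /F.
  case: unpickle => [a|]; last exact: negligible_set0.
  case: asboolP => [Ba0|_]; last exact: negligible_set0.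
  exact/negligibleP.
move=> x /= /existsNP[U /not_implyP[oU /not_implyP[Ux muU]]].
have [q [k [Bx BU]]] := rat_ball_nbhs oU Ux.
exists (pickle (q, k)) => //; rewrite /F pickleK.
case: asboolP => // -[]; apply/eqP; rewrite eq_le measure_ge0 andbT.
move: muU => /negP; rewrite -leNgt; apply: le_trans.
by apply: le_measure => //; rewrite inE//; exact: open_borel_rV.
Qed.

End Support.

Section IntegralBounds.
Context {R : realType} {n : nat} (mu : {measure set (borel_rV R n) -> \bar R}).
Implicit Types (p : mpoly n R) (U : set 'rV[R]_n).

Lemma integral_peval_ge p (c : R) U : (forall H, 0 <= peval p H) -> 0 <= c ->
  open U -> (forall H, U H -> c <= peval p H) ->
  (c%:E * mu U <= \int[mu]_(H in setT) (peval p H)%:E)%E.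
Proof.
move=> p0 c0 oU cp; have mU := open_borel_rV oU.
rewrite -(integral_cst mu mU).
apply: (@le_trans _ _
  (\int[mu]_(H in (U : set (borel_rV R n))) (peval p H)%:E)%E).
  by apply: ge0_le_integral => //; exact: peval_measurable.
apply: ge0_subset_integral => //; first exact: peval_measurable.
by move=> x _; rewrite lee_fin.
Qed.

Lemma integral_peval_le p (c : R) U : (forall H, 0 <= peval p H) -> 0 <= c ->
  open U -> mu U = 0%E -> mu setT = 1%E ->
  (forall H, measure_support mu H -> ~ U H -> peval p H <= c) ->
  (\int[mu]_(H in setT) (peval p H)%:E <= c%:E)%E.
Proof.
move=> p0 c0 oU muU mu1 pc.
have mU := open_borel_rV oU.
have mS : measurable (~` measure_support mu : set (borel_rV R n)).
  by apply: open_borel_rV; rewrite openC; exact: measure_support_closed.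
pose N := (U : set (borel_rV R n)) `|` ~` measure_support mu.
have mN : measurable N by exact: measurableU.
have N0 : mu N = 0%E.
  apply/(negligibleP _ mN); apply: negligibleU; first exact/(negligibleP _ mU).
  exact/(negligibleP _ mS)/measure_support_null.
rewrite (ge0_negligible_integral mN) //.
- apply: (@le_trans _ _ (\int[mu]_(H in setT `\` N) c%:E)%E).
    apply: ge0_le_integral => //.
    + exact: measurableD.
    + by move=> x _; rewrite lee_fin.
    + exact: peval_measurable.
    + move=> x [_ Nx]; rewrite lee_fin; apply: pc.
        by apply: contrapT => Sx; apply: Nx; right.
      by move=> Ux; apply: Nx; left.
  rewrite integral_cst//; last exact: measurableD.
  rewrite -[leRHS]mule1 lee_wpmul2l ?lee_fin// -mu1.
  by apply: le_measure; rewrite ?inE//; exact: measurableD.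
- exact: peval_measurable.
- by move=> x _; rewrite lee_fin.
Qed.

End IntegralBounds.

Section Representation.
Context {R : realType} {n : nat} (V : mpoly n R -> mpoly n R).
Context (mu : 'rV[R]_n -> {measure set (borel_rV R n) -> \bar R}).
Hypothesis hmu : forall (p : mpoly n R) (X : 'rV[R]_n),
  (peval (V p) X)%:E = (\int[mu X]_(H in setT) (peval p H)%:E)%E.
Hypothesis V1 : V 1 = 1.
Implicit Types (p : mpoly n R) (x : 'rV[R]_n).

Lemma representing_mass x : mu x setT = 1%E.
Proof.
have := hmu 1 x; rewrite V1 /peval meval1.
under eq_integral do rewrite meval1.
by rewrite integral_cst// mul1e => <-.
Qed.

Lemma representing_ge0 p x : (forall H, 0 <= peval p H) -> 0 <= peval (V p) x.
Proof.
by move=> p0; rewrite -lee_fin hmu; apply: integral_ge0 => H _; rewrite lee_fin.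
Qed.

(** The constant [a] is the mass of [U]. It is independent of [p], so it stays fixed when [p] runs
    through high powers. *)
Lemma representing_ge x H0 (U : set 'rV[R]_n) :
  measure_support (mu x) H0 -> open U -> U H0 ->
  exists2 a : R, 0 < a & forall p c, (forall H, 0 <= peval p H) -> 0 <= c ->
    (forall H, U H -> c <= peval p H) -> a * c <= peval (V p) x.
Proof.
move=> SH oU UH; have muU := SH U oU UH.
have muUfin : mu x U \is a fin_num.
  rewrite ge0_fin_numE//; apply: (@le_lt_trans _ _ (mu x setT)).
    by apply: le_measure; rewrite ?inE//; exact: open_borel_rV.
  by rewrite representing_mass ltry.
exists (fine (mu x U)); first by rewrite fine_gt0// muU -ge0_fin_numE.
move=> p c p0 c0 cp; rewrite -lee_fin hmu EFinM fineK// muleC.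
exact: integral_peval_ge.
Qed.

(** [U] is a null neighbourhood of [K], so values of [p] on it do not matter, and the total mass is
    1. *)
Lemma representing_le x K : ~ measure_support (mu x) K ->
  exists2 U : set 'rV[R]_n, open U /\ U K &
    forall p c, (forall H, 0 <= peval p H) -> 0 <= c ->
    (forall H, measure_support (mu x) H -> ~ U H -> peval p H <= c) ->
    peval (V p) x <= c.
Proof.
move=> /existsNP[U /not_implyP[oU /not_implyP[Ux muU]]]; exists U => //.
move=> p c p0 c0 pc; rewrite -lee_fin hmu.
apply: (integral_peval_le p0 c0 oU) => //; last exact: representing_mass.
apply/eqP; rewrite eq_le measure_ge0 andbT.
by move: muU => /negP; rewrite -leNgt.
Qed.

Lemma representing_support_nonempty x : measure_support (mu x) !=set0.
Proof.
have S0 := measure_support_null (mu x); apply/set0P/eqP => Sx.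
by move: S0; rewrite Sx setC0 representing_mass => /eqP; rewrite onee_eq0.
Qed.

End Representation.

(** * The support lies in the hull of the orbit *)

Section RadialDerivation.
Context {R : realType} {n : nat}.
Implicit Types (p q : mpoly n R) (x y : 'rV[R]_n).

Lemma radialM x p q : radial x (p * q) = radial x p * q + p * radial x q.
Proof.
rewrite /radial mulr_suml mulr_sumr -big_split; apply: eq_bigr => k _ /=.
by rewrite mderivM mulrDr; congr (_ + _); [rewrite mulrA | rewrite mulrCA].
Qed.

Lemma radialD x p q : radial x (p + q) = radial x p + radial x q.
Proof.
by rewrite /radial -big_split; apply: eq_bigr => k _; rewrite mderivD mulrDr.
Qed.

Lemma radialZ x (c : R) p : radial x (c *: p) = c *: radial x p.
Proof.
by rewrite /radial scaler_sumr; apply: eq_bigr => k _; rewrite mderivZ scalerAr.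
Qed.

Lemma radialC x c : radial x (mpolyC n c) = 0.
Proof. by rewrite /radial big1// => k _; rewrite mderivC mulr0. Qed.

Lemma radial_mvar x k : radial x (mvar k) = mvar k - x ord0 k *: 1.
Proof.
rewrite /radial (bigD1 k)//= big1 ?addr0 => [|i ik].
  rewrite mderivX mnm1E eqxx scale1r -{1}[mnm1 k]add0m addmK.
  by rewrite mpolyX0 mulr1.
by rewrite mderivX mnm1E eq_sym (negPf ik) scale0r mulr0.
Qed.

Lemma radialX x p d : radial x (p ^+ d.+1) = d.+1%:R *: (p ^+ d * radial x p).
Proof.
elim: d => [|d IHd]; first by rewrite expr1 expr0 mul1r scale1r.
rewrite exprS radialM IHd -scalerAr mulrA -exprS [radial x p * _]mulrC.
by rewrite -[d.+2%:R]natr1 scalerDl scale1r addrC.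
Qed.

Definition affine_poly (v : 'rV[R]_n) (c : R) : mpoly n R :=
  \sum_(k < n) v ord0 k *: mvar k + mpolyC n c.

Lemma peval_affine v c x :
  peval (affine_poly v c) x = \sum_(k < n) v ord0 k * x ord0 k + c.
Proof.
rewrite /peval mevalD mevalC raddf_sum; congr (_ + _).
by apply: eq_bigr => k _ /=; rewrite mevalZ mevalXU.
Qed.

Lemma radial_affine x v c : radial x (affine_poly v c) =
  affine_poly v c - mpolyC n (peval (affine_poly v c) x).
Proof.
rewrite {1}/affine_poly radialD radialC addr0 peval_affine.
rewrite (big_morph (radial x) (radialD x) (radialC x 0)).
rewrite mpolyCD opprD addrACA subrr addr0.
rewrite (raddf_sum (@mpolyC n R)) -sumrB.
apply: eq_bigr => k _; rewrite radialZ radial_mvar scalerBr scalerA.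
by rewrite alg_mpolyC.
Qed.

End RadialDerivation.

(** * Maximum principle on the orbit *)

Section MaximumPrinciple.
Context {R : realType} {n : nat} (m : R).
Hypothesis m_ge0 : 0 <= m.
Context (V : {linear mpoly n R -> mpoly n R}).
Hypothesis hV : dunkl_intertwining m V.

Lemma intertwining1 : V 1 = 1.
Proof. by case: hV => _ _; apply; rewrite /homog_polys /=; exact: dhomog1. Qed.

(** Induction on [d]. For an affine form [l] the radial relation at [y] reads (d+1) (L_y l^(d+1) -
    l(y) L_y l^d) = - m/2 S, with S a sum of differences over transpositions. Where the left moment
    is largest in absolute value on the orbit, S has its sign or vanishes. *)
Lemma intertwining_affine_bound (v x : 'rV[R]_n) c B :
  (forall s, `|peval (affine_poly v c) (col_perm s x)| <= B) ->
  forall d s, `|peval (V (affine_poly v c ^+ d)) (col_perm s x)| <= B ^+ d.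
Proof.
set l := affine_poly v c => lB.
have B0 : 0 <= B := le_trans (normr_ge0 _) (lB 1%g).
elim=> [|d IHd] s.
  by rewrite expr0 intertwining1 /peval meval1 normr1.
pose f s := peval (V (l ^+ d.+1)) (col_perm s x).
rewrite -/(f s).
have [s0 _ fmax] := @Order.TotalTheory.arg_maxP _ _ _ (1%g : 'S_n) xpredT
  (fun s => `|f s|) isT.
apply: le_trans (fmax s isT) _.
set y := col_perm s0 x.
have := radial_intertwining (l ^+ d.+1) y hV.
rewrite radialX radial_affine -/l mulrBr -exprSr linearZ_LR linearB /=.
rewrite [l ^+ d * _]mulrC mul_mpolyC linearZ_LR.
rewrite [LHS]/peval mevalZ mevalB mevalZ -![meval _ _]/(peval _ _) -/(f s0).
set g := peval (V (l ^+ d)) y.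
have gB : `|g| <= B ^+ d by exact: IHd.
set S := \sum_(i < n) _ => rec.
have S0 : 0 <= f s0 * S.
  rewrite mulr_sumr sumr_ge0// => i _; rewrite mulr_sumr sumr_ge0// => j _.
  rewrite -col_permM -/(f _) mulrBr subr_ge0.
  apply: le_trans (ler_norm _) _; rewrite normrM -expr2 -real_normK ?num_real//.
  by rewrite expr2 ler_wpM2l//; exact: fmax.
(* Multiplying the relation by [f s0] makes the right side nonpositive whatever the sign of
   [f s0]. *)
have fle : `|f s0| ^+ 2 <= `|f s0| * B ^+ d.+1.
  apply: (@le_trans _ _ (f s0 * (peval l y * g))); last first.
    apply: le_trans (ler_norm _) _; rewrite normrM ler_wpM2l// normrM exprS.
    by apply: ler_pM => //; exact: lB.
  rewrite real_normK ?num_real// expr2 -subr_le0 -mulrBr.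
  have d0 : (0 : R) < d.+1%:R by rewrite ltr0n.
  rewrite -(pmulr_rle0 _ d0) mulrCA rec mulrN mulrCA oppr_le0.
  by rewrite mulr_ge0// divr_ge0.
have [->|f0] := eqVneq `|f s0| 0; first exact: exprn_ge0.
by move: fle; rewrite expr2 ler_pM2l// lt_neqAle eq_sym f0 normr_ge0.
Qed.

End MaximumPrinciple.

(** * Separating a point from the hull of finitely many points *)

Section Separation.
Context {R : realType} {n : nat}.
Implicit Types (A : set 'rV[R]_n) (x y v : 'rV[R]_n).

Lemma convex_setP A : @convex_set R 'rV[R]_n A <->
  forall x y (s : R), 0 <= s <= 1 -> A x -> A y -> A (s *: x + (1 - s) *: y).
Proof.
split=> [cA x y s /andP[s0 s1] Ax Ay|cA x y s].
  by have := cA x y (Itv01 s0 s1) (mem_set Ax) (mem_set Ay); rewrite inE.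
rewrite !inE => Ax Ay; apply: cA => //.
by rewrite ge0 le1.
Qed.

Lemma smallest_convex A :
  @convex_set R 'rV[R]_n (smallest (@convex_set R 'rV[R]_n) A).
Proof.
apply/convex_setP => x y s s01 hx hy C [cC AC].
by have /convex_setP := cC; apply => //; [apply: hx | apply: hy].
Qed.

Lemma convex_set_comb N (P : 'M[R]_(N, n)) A (t : 'rV[R]_N) :
  @convex_set R 'rV[R]_n A -> (forall i, A (row i P)) ->
  (forall i, 0 <= t ord0 i) -> \sum_i t ord0 i = 1 -> A (t *m P).
Proof.
move=> /convex_setP cA PA t0 t1.
have [i0 _] : exists i0 : 'I_N, True.
  case: N P t PA t0 t1 => [|N] P t PA t0; last by exists ord0.
  by rewrite big_ord0 => /eqP; rewrite eq_sym oner_eq0.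
(* Invariant for partial sums: total weight times some point of [A]. If the weight is zero, any
   point of [A] will do. *)
have [a Aa ta] : exists2 a, A a &
    \sum_i t ord0 i *: row i P = (\sum_i t ord0 i) *: a.
  elim: (index_enum _) => [|i r [a Aa IH]].
    by exists (row i0 P) => //; rewrite !big_nil scale0r.
  have r0 : 0 <= \sum_(j <- r) t ord0 j by exact: sumr_ge0.
  rewrite !big_cons IH.
  have [s0|s0] := eqVneq (t ord0 i + \sum_(j <- r) t ord0 j) 0.
    exists a => //; rewrite s0 scale0r.
    have [ti0 tr0] : t ord0 i = 0 /\ \sum_(j <- r) t ord0 j = 0.
      by have := t0 i; split; lra.
    by rewrite ti0 tr0 !scale0r addr0.
  set s := _ + _ in s0 *.
  have s_gt0 : 0 < s by rewrite lt_neqAle eq_sym s0 addr_ge0.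
  exists (t ord0 i / s *: row i P + (1 - t ord0 i / s) *: a).
    apply: cA => //; rewrite divr_ge0 ?(ltW s_gt0)//= ler_pdivrMr// mul1r.
    by rewrite lerDl.
  rewrite scalerDr !scalerA mulrBr mulr1 [s * _]mulrC divfK// /s.
  by rewrite addrAC subrr add0r.
by rewrite mulmx_sum_row ta t1 scale1r.
Qed.

Definition dotv x y : R := \sum_k x ord0 k * y ord0 k.

Lemma dotvDr v x y : dotv v (x + y) = dotv v x + dotv v y.
Proof.
by rewrite /dotv -big_split; apply: eq_bigr => k _; rewrite mxE mulrDr.
Qed.

Lemma dotvZr v (c : R) x : dotv v (c *: x) = c * dotv v x.
Proof.
by rewrite /dotv mulr_sumr; apply: eq_bigr => k _; rewrite mxE mulrCA.
Qed.

Lemma dotvC x y : dotv x y = dotv y x.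
Proof. by apply: eq_bigr => k _; rewrite mulrC. Qed.

Lemma dotv_ge0 x : 0 <= dotv x x.
Proof. by apply: sumr_ge0 => k _; rewrite -expr2 sqr_ge0. Qed.

Lemma dotv_eq0 x : dotv x x = 0 -> x = 0.
Proof.
move=> /eqP; rewrite psumr_eq0 => [/allP x0|k _]; last first.
  by rewrite -expr2 sqr_ge0.
apply/rowP => k; rewrite mxE.
have /implyP/(_ isT) := x0 k (mem_index_enum _).
by rewrite mulf_eq0 orbb => /eqP.
Qed.

Lemma dotv_sub x y c :
  dotv (x - c *: y) (x - c *: y) =
    dotv x x - c * (dotv x y *+ 2) + c ^+ 2 * dotv y y.
Proof.
rewrite -scaleNr dotvDr dotvZr ![dotv (_ + _) _]dotvC !dotvDr !dotvZr.
by rewrite [dotv y x]dotvC; ring.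
Qed.

Definition simplex N : set 'rV[R]_N :=
  [set t | (forall i, 0 <= t ord0 i) /\ \sum_i t ord0 i = 1].

Lemma simplex_le1 N (t : 'rV[R]_N) i : simplex t -> t ord0 i <= 1.
Proof.
by move=> [t0 <-]; rewrite (bigD1 i)//= lerDl sumr_ge0.
Qed.

Lemma simplex_compact N : compact (@simplex N).
Proof.
rewrite (_ : @simplex N =
    [set t : 'rV[R]_N | forall i, `[0, 1]%classic (t ord0 i)]
    `&` (peval (affine_poly (const_mx 1) 0)) @^-1` [set 1]).
  apply: compact_closedI.
    exact: (@rV_compact R N (fun=> `[0, 1]%classic)
      (fun=> @segment_compact R 0 1)).
  have /continuous_closedP cc :=
    @peval_continuous R N (affine_poly (const_mx 1) 0).
  by apply: cc; exact: closed_eq.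
apply/seteqP; split=> t /=; rewrite peval_affine addr0;
  under eq_bigr do rewrite mxE mul1r.
  move=> ht; split; last exact: ht.2.
  by move=> i; rewrite in_itv/= ht.1 simplex_le1.
by move=> [t0 t1]; split=> // i; have := t0 i; rewrite in_itv/= => /andP[].
Qed.

(** Let [c] be the combination of the rows nearest to [x], found by minimising over the compact
    simplex of weights. Then u = x - c is a separating normal, by the first variation towards each
    row. *)
Lemma hull_separation N (P : 'M[R]_(N.+1, n)) A x :
  @convex_set R 'rV[R]_n A -> (forall i, A (row i P)) -> ~ A x ->
  exists (v : 'rV[R]_n) (b : R),
    (forall i, dotv v (row i P) <= b) /\ b < dotv v x.
Proof.
move=> cA PA nAx.
pose d (t : 'rV[R]_N.+1) := dotv (x - t *m P) (x - t *m P).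
(* The squared distance as a polynomial in the weights, which makes it continuous. *)
pose p := \sum_(k < n) affine_poly (- (col k P)^T) (x ord0 k) ^+ 2.
have pd t : peval p t = d t.
  rewrite peval_sum; apply: eq_bigr => k _.
  rewrite /peval rmorphXn /= -/(peval _ _) peval_affine !mxE expr2.
  have -> : \sum_(i < N.+1) (- (col k P)^T) ord0 i * t ord0 i =
      - \sum_(i < N.+1) t ord0 i * P i k.
    by rewrite -sumrN; apply: eq_bigr => i _; rewrite !mxE mulNr mulrC.
  by rewrite addrC.
have e0 (i : 'I_N.+1) : simplex (delta_mx ord0 i : 'rV[R]_N.+1).
  split=> [j|]; first by rewrite mxE ler0n.
  rewrite (bigD1 i)//= big1 ?addr0 ?mxE ?eqxx// => j ji.
  by rewrite mxE (negPf ji) andbF.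
have [t /set_mem ht tmin] := @EVT_min_rV _ _ (peval p) _
  (ex_intro _ _ (e0 ord0)) (@simplex_compact N.+1)
  (continuous_subspaceT (@peval_continuous _ _ p)).
set c := t *m P; set u := x - c.
have u0 : u != 0.
  rewrite subr_eq0; apply/eqP => xc; apply: nAx; rewrite xc.
  by case: ht => t0 t1; exact: convex_set_comb.
have uu : 0 < dotv u u.
  rewrite lt_neqAle dotv_ge0 andbT eq_sym; apply: contra u0 => /eqP.
  by move/dotv_eq0 ->.
exists u, (dotv u c); split; last first.
  have -> : dotv u x = dotv u c + dotv u u.
    by rewrite -dotvDr [c + u]addrC /u subrK.
  by rewrite ltrDl.
move=> i; rewrite leNgt; apply/negP => ci.
pose w := row i P - c; have uw : 0 < dotv u w.
  by rewrite /w -scaleN1r dotvDr dotvZr mulN1r subr_gt0.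
have h e : 0 <= e <= 1 -> 0 <= - (e * (dotv u w *+ 2)) + e ^+ 2 * dotv w w.
  move=> /andP[e1 e2]; pose t' := (1 - e) *: t + e *: delta_mx ord0 i.
  have ht' : simplex t'.
    case: ht => t0 t1; case: (e0 i) => d0 d1; split=> [j|].
      by rewrite mxE addr_ge0// mxE mulr_ge0// subr_ge0.
    under eq_bigr do rewrite mxE [X in X + _]mxE [X in _ + X]mxE.
    by rewrite big_split /= -!mulr_sumr t1 d1 !mulr1 subrK.
  have := tmin t' (mem_set ht'); rewrite !pd /d -/c -/u.
  have -> : x - t' *m P = u - e *: w.
    rewrite /u /t' mulmxDl -!scalemxAl -rowE -/c -addrA -opprD; congr (_ - _).
    by rewrite /w scalerBl scale1r scalerBr addrA addrAC.
  by rewrite dotv_sub; lra.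
have ww := dotv_ge0 w.
set a := dotv u w in uw h *; set b := dotv w w in ww h *.
have ab : 0 < a + b by lra.
(* At this step length e the variation - 2 e a + e^2 b equals - e^2 (2 a + b), which is negative. *)
have := h (a / (a + b)).
rewrite divr_ge0 ?(ltW uw) ?(ltW ab)//= ler_pdivrMr// mul1r lerDl => /(_ ww).
have -> : - (a / (a + b) * (a *+ 2)) + (a / (a + b)) ^+ 2 * b =
    - ((a / (a + b)) * (a / (a + b)) * (2 * a + b)).
  by field; rewrite gt_eqF.
have r0 : 0 < a / (a + b) by exact: divr_gt0.
have ab2 : 0 < 2 * a + b by lra.
by rewrite oppr_ge0 leNgt (mulr_gt0 (mulr_gt0 r0 r0) ab2).
Qed.

End Separation.

Lemma exp_beats {R : realType} (a b c : R) : 0 < a -> 0 <= b -> b < c ->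
  exists d, b ^+ d < a * c ^+ d.
Proof.
move=> a0 b0 bc; have c0 : 0 < c by exact: le_lt_trans bc.
have : `|b / c| < 1.
  by rewrite ger0_norm ?divr_ge0 ?(ltW c0)// ltr_pdivrMr// mul1r.
move=> /cvg_expr/cvgrPdist_lt/(_ a a0)[d _ /(_ d (leqnn d))] /=.
rewrite sub0r normrN ger0_norm ?exprn_ge0 ?divr_ge0 ?(ltW c0)//.
rewrite expr_div_n ltr_pdivrMr ?exprn_gt0// => h.
by exists d.
Qed.

Section Upper.
Context {R : realType} {n : nat} (m : R).
Hypothesis m_ge0 : 0 <= m.
Context (V : {linear mpoly n R -> mpoly n R}).
Hypothesis hV : dunkl_intertwining m V.
Context (mu : 'rV[R]_n -> {measure set (borel_rV R n) -> \bar R}).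
Hypothesis hmu : forall (p : mpoly n R) (X : 'rV[R]_n),
  (peval (V p) X)%:E = (\int[mu X]_(H in setT) (peval p H)%:E)%E.
Implicit Types (x K : 'rV[R]_n).

Lemma orbit_hull_orbit x s : orbit_hull x (col_perm s x).
Proof. by move=> A [_ hA]; apply: hA; exists s. Qed.

(** A support point [K] outside the hull would make the moments of a separating form [l] grow like
    powers of [C], while the maximum principle allows only powers of the smaller number b + c. *)
Lemma support_sub_hull x : measure_support (mu x) `<=` orbit_hull x.
Proof.
move=> K SK; apply: contrapT => nK.
have [N hN] : exists N, #|{perm 'I_n}| = N.+1.
  by exists #|{perm 'I_n}|.-1; rewrite prednK//; apply/card_gt0P; exists 1%g.
pose P := \matrix_i col_perm (enum_val (cast_ord (esym hN) i)) x.
have rowP' i : row i P = col_perm (enum_val (cast_ord (esym hN) i)) x.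
  by rewrite rowK.
have [|v [b [vb bK]]] := hull_separation (@smallest_convex _ _ _) _ nK (P := P).
- by move=> i; rewrite rowP'; exact: orbit_hull_orbit.
have {}vb s : dotv v (col_perm s x) <= b.
  have := vb (cast_ord hN (enum_rank s)).
  by rewrite rowP' cast_ordK enum_rankK.
(* This shift makes [l] nonnegative on the orbit, so that the one-sided bound by b + c bounds its
   absolute value. *)
pose c := \sum_(s : 'S_n) `|dotv v (col_perm s x)| + `|b|.
pose l := affine_poly v c; have lE y : peval l y = dotv v y + c.
  exact: peval_affine.
have lB s : `|peval l (col_perm s x)| <= b + c.
  have hs : `|dotv v (col_perm s x)| <=
      \sum_(s : 'S_n) `|dotv v (col_perm s x)|.
    by rewrite (bigD1 s)//= lerDl sumr_ge0.
  have := vb s; move: hs; rewrite lE /c; set S := \sum_(_ | _) _.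
  have := ler_norm b; have := ler_norm (- b); rewrite normrN.
  set t := dotv _ _; rewrite !ler_norml => h1 h2 /andP[h3 h4] h5.
  by apply/andP; split; lra.
have B0 : 0 <= b + c := le_trans (normr_ge0 _) (lB 1%g).
have lbound d : peval (V (l ^+ d)) x <= (b + c) ^+ d.
  apply: le_trans (ler_norm _) _.
  by have := intertwining_affine_bound m_ge0 hV lB d 1%g; rewrite col_perm1.
pose C := (b + dotv v K) / 2 + c.
have BC : b + c < C by rewrite /C; lra.
pose U := peval l @^-1` [set y | y > C].
have oU : open U.
  have /continuousP cl := @peval_continuous _ _ l.
  by apply: cl; exact: open_gt.
have UK : U K by rewrite /U /= lE /C; lra.
have [a a0 ha] := representing_ge hmu (intertwining1 hV) SK oU UK.
have C0 : 0 <= C := ltW (le_lt_trans B0 BC).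
(* Even powers are used because the test polynomial must be nonnegative everywhere. *)
have BC2 : (b + c) ^+ 2 < C ^+ 2 by rewrite ltr_sqr.
have [d] := exp_beats a0 (sqr_ge0 _) BC2.
rewrite -!exprM ltNge => /negP; apply; apply: le_trans _ (lbound _).
apply: ha => [H||H UH]; last 1 first.
- rewrite /peval rmorphXn /= -/(peval _ _) lerXn2r// ?nnegrE//.
    exact: le_trans C0 (ltW UH).
  exact: ltW.
- by rewrite /peval rmorphXn /= exprM exprn_ge0// sqr_ge0.
- exact: exprn_ge0.
Qed.

End Upper.

(** * The hull of the orbit lies in the support *)

(** The derivative of s^(K+1) f is s^K times the bounded expression. The mean value theorem gives
    the increase on [a, b] and monotonicity on [b, 1]. *)
Lemma poly_growth {R : realType} (f : {poly R}) K (a b c : R) :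
  0 < a -> a < b -> b <= 1 -> 0 <= c -> 0 <= f.[a] ->
  (forall s, 0 <= s <= 1 -> 0 <= K.+1%:R * f.[s] + s * f^`().[s]) ->
  (forall s, a <= s <= b -> c <= K.+1%:R * f.[s] + s * f^`().[s]) ->
  a ^+ K * c * (b - a) <= f.[1].
Proof.
move=> a0 ab b1 c0 fa fpos fc.
pose g : {poly R} := 'X^(K.+1) * f.
have gE s : g.[s] = s ^+ K.+1 * f.[s] by rewrite hornerM hornerXn.
have g'E s : g^`().[s] = s ^+ K * (K.+1%:R * f.[s] + s * f^`().[s]).
  rewrite derivM derivXn hornerD !hornerM hornerMn !hornerXn /=.
  by rewrite mulrDr mulrA exprSr mulr_natr mulrA.
have gab : a ^+ K * c * (b - a) <= g.[b] - g.[a].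
  have [s /itvP hs ->] := polyrcf.poly_mvt g ab.
  rewrite ler_wpM2r ?subr_ge0 ?(ltW ab)// g'E.
  apply: ler_pM; rewrite ?exprn_ge0 ?(ltW a0)//.
    by apply: lerXn2r; rewrite ?nnegrE ?(ltW a0) ?hs// (le_trans (ltW a0)) ?hs.
  by apply: fc; rewrite !hs.
have gb1 : g.[b] <= g.[1].
  have [->//|bn1] := eqVneq b 1; have {}b1 : b < 1 by rewrite lt_neqAle bn1.
  have [s /itvP hs h] := polyrcf.poly_mvt g b1.
  rewrite -subr_ge0 h mulr_ge0 ?subr_ge0 ?(ltW b1)// g'E.
  have s0 : 0 <= s by rewrite (le_trans (ltW (lt_trans a0 ab)))// hs.
  by rewrite mulr_ge0 ?exprn_ge0// fpos// s0 hs.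
have ga : 0 <= g.[a] by rewrite gE mulr_ge0// exprn_ge0// ltW.
by move: gb1; rewrite (gE 1) expr1n mul1r; lra.
Qed.

(** * Dilations about a point *)

Section Dilation.
Context {R : realType} {n : nat}.
Implicit Types (p q : mpoly n R) (x y H : 'rV[R]_n).

(* The coefficients of [F] are the components of [p] homogeneous about [x]. *)
Definition dilation x p (F : {poly mpoly n R}) : Prop :=
  (forall k, radial x F`_k = k%:R *: F`_k) /\
  forall (s : R) H, peval F.[mpolyC n s] H = peval p (x + s *: (H - x)).

(** The property holds for constants and variables and passes to sums and products, because
    [radial x] is a derivation. *)
Lemma dilation_exists x p : exists F, dilation x p F.
Proof.
have DC c : exists F, dilation x (mpolyC n c) F.
  exists (mpolyC n c)%:P; split=> [k|s H].
    rewrite coefC; case: eqP => [->|_]; first by rewrite radialC scale0r.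
    by rewrite -[0](mpolyC0 n) radialC mpolyC0 scaler0.
  by rewrite hornerC /peval !mevalC.
have DD q r : (exists F, dilation x q F) -> (exists F, dilation x r F) ->
    exists F, dilation x (q + r) F.
  move=> [F [F1 F2]] [G [G1 G2]]; exists (F + G); split=> [k|s H].
    by rewrite coefD radialD F1 G1 scalerDr.
  by rewrite hornerD /peval !mevalD -![meval _ _]/(peval _ _) F2 G2.
have DM q r : (exists F, dilation x q F) -> (exists F, dilation x r F) ->
    exists F, dilation x (q * r) F.
  move=> [F [F1 F2]] [G [G1 G2]]; exists (F * G); split=> [k|s H].
    rewrite coefM (big_morph (radial x) (radialD x) (radialC x 0)) scaler_sumr.
    apply: eq_bigr => i _; rewrite radialM F1 G1 -scalerAl -scalerAr -scalerDl.
    by rewrite -natrD subnKC// -ltnS.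
  by rewrite hornerM /peval !mevalM -![meval _ _]/(peval _ _) F2 G2.
have DX k : exists F, dilation x (mvar k) F.
  exists ((mpolyC n (x ord0 k))%:P + (mvar k - mpolyC n (x ord0 k))%:P * 'X).
  split=> [i|s H].
    rewrite coefD coefC coefCM coefX.
    case: i => [|[|i]] /=; rewrite ?mulr0 ?addr0 ?add0r ?mulr1.
    - by rewrite radialC scale0r.
    - by rewrite -scaleN1r radialD radialZ radialC scaler0 addr0 radial_mvar
        alg_mpolyC scaleN1r scale1r.
    - by rewrite -[0](mpolyC0 n) radialC mpolyC0 scaler0.
  rewrite hornerD hornerM !hornerC hornerX peval_mvar /peval.
  rewrite mevalD mevalM mevalB !mevalC mevalXU !mxE; ring.
elim/mpolyind: p => [|c u p _ _ IHp]; first by rewrite -[0](mpolyC0 n).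
apply: (DD) => //; rewrite -mul_mpolyC; apply: (DM) => //.
rewrite mpolyXE_id; elim/big_ind: _ => [||k _].
- by rewrite -(mpolyC1 n).
- exact: DM.
elim: (u k) => [|e IHe]; first by rewrite expr0 -(mpolyC1 n).
by rewrite exprS; apply: (DM) => //; exact: DX.
Qed.

End Dilation.

(** * Transport of the support along segments *)

Section Star.
Context {R : realType} {n : nat} (m : R).
Hypothesis m_gt0 : 0 < m.
Context (V : {linear mpoly n R -> mpoly n R}).
Hypothesis hV : dunkl_intertwining m V.
Context (mu : 'rV[R]_n -> {measure set (borel_rV R n) -> \bar R}).
Hypothesis mu_compact : forall X, compact (measure_support (mu X)).
Hypothesis hmu : forall (p : mpoly n R) (X : 'rV[R]_n),
  (peval (V p) X)%:E = (\int[mu X]_(H in setT) (peval p H)%:E)%E.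
Implicit Types (x y H : 'rV[R]_n) (p : mpoly n R) (F : {poly mpoly n R}).

(** The function s -> L_y (p (x + s (H - x))), kept as a polynomial in s so that it can be
    differentiated formally. *)
Definition profile y F : {poly R} := \poly_(k < size F) peval (V F`_k) y.

Lemma profileE y F (s : R) :
  (profile y F).[s] = peval (V F.[mpolyC n s]) y.
Proof.
rewrite horner_poly horner_coef linear_sum peval_sum; apply: eq_bigr => k _.
rewrite -rmorphXn [F`_k * _]mulrC /= mul_mpolyC linearZ_LR.
by rewrite [RHS]mevalZ mulrC.
Qed.

(** On the k-th coefficient [radial x] acts as multiplication by k, just as s d/ds acts on s^k; the
    radial relation for the dilated polynomial then applies. *)
Lemma profile_deriv x p F (s : R) : dilation x p F ->
  s * (profile x F)^`().[s] = - (m / 2 *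
    \sum_(i < n) \sum_(j < n | (i < j)%N)
      ((profile x F).[s] - (profile (col_perm (tperm i j) x) F).[s])).
Proof.
move=> [radF _].
pose G := \sum_(k < size F) F`_k * (mpolyC n s) ^+ k.
have sG : radial x G = \sum_(k < size F) (k%:R * s ^+ k) *: F`_k.
  rewrite (big_morph (radial x) (radialD x) (radialC x 0)).
  apply: eq_bigr => k _; rewrite -rmorphXn [F`_k * _]mulrC /= mul_mpolyC.
  rewrite radialZ radF.
  by rewrite scalerA mulrC.
have -> : s * (profile x F)^`().[s] = peval (V (radial x G)) x.
  rewrite sG linear_sum peval_sum /profile poly_def.
  rewrite (raddf_sum (@deriv R)) horner_sum mulr_sumr.
  apply: eq_bigr => k _ /=; rewrite derivZ hornerZ derivXn hornerMn hornerXn.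
  rewrite linearZ_LR /peval mevalZ mulrCA mulrC; congr (_ * _).
  case: (k : nat) => [|e]; first by rewrite mulr0n mulr0 mul0r.
  by rewrite mulrnAr exprS mulr_natl.
rewrite (radial_intertwining _ _ hV); congr (- (_ * _)).
by apply: eq_bigr => i _; apply: eq_bigr => j _; rewrite !profileE horner_coef.
Qed.

Lemma profile_ge0 x y p F (s : R) : (forall H, 0 <= peval p H) ->
  dilation x p F -> 0 <= (profile y F).[s].
Proof.
move=> p0 [_ Fp]; rewrite profileE.
by apply: (representing_ge0 hmu) => H; rewrite Fp.
Qed.

(* With [f s = L_x (p (x + s (H - x)))], the radial relation bounds
   [M f + s f'] from below by the mass near [H0]; [s ^ K] with an integer
   [K >= M] then serves as integrating factor in [poly_growth]. *)
Lemma star_lower_bound x (i j : 'I_n) H0 (W : set 'rV[R]_n) (a b : R) :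
  (i < j)%N -> measure_support (mu (col_perm (tperm i j) x)) H0 ->
  open W -> W H0 -> 0 < a -> a < b -> b <= 1 ->
  exists2 k : R, 0 < k & forall p c, (forall H, 0 <= peval p H) -> 0 <= c ->
    (forall s H, a <= s <= b -> W H -> c <= peval p (x + s *: (H - x))) ->
    k * c <= peval (V p) x.
Proof.
move=> ij SH oW WH a0 ab b1.
have [w w0 hw] := representing_ge hmu (intertwining1 hV) SH oW WH.
pose M : R := m / 2 * \sum_(i < n) \sum_(j < n | (i < j)%N) 1.
(* Then [K.+1 >= M], and raising the coefficient [M] to [K.+1] preserves lower bounds since the
   profile is nonnegative. *)
pose K := Num.truncn M.
have MK : M <= K.+1%:R by exact: ltW (truncnS_gt _).
exists (a ^+ K * (m / 2 * w) * (b - a)).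
  by rewrite !mulr_gt0 ?exprn_gt0 ?subr_gt0 ?divr_gt0.
move=> p c p0 c0 pc; have [F hF] := dilation_exists x p.
have P0 y s : 0 <= (profile y F).[s] by exact: profile_ge0 p0 hF.
have rec s : M * (profile x F).[s] + s * (profile x F)^`().[s] =
    m / 2 * \sum_(i < n) \sum_(j < n | (i < j)%N)
      (profile (col_perm (tperm i j) x) F).[s].
  rewrite (profile_deriv s hF) /M -mulrA -mulrBr; congr (_ * _).
  rewrite mulr_suml -sumrB; apply: eq_bigr => k _.
  rewrite mulr_suml -sumrB; apply: eq_bigr => l _.
  by rewrite mul1r subKr.
(* All terms of [rec] are nonnegative, so only the pair (i, j) is kept. *)
have low s : m / 2 * (profile (col_perm (tperm i j) x) F).[s] <=
    K.+1%:R * (profile x F).[s] + s * (profile x F)^`().[s].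
  apply: (@le_trans _ _ (M * (profile x F).[s] + s * (profile x F)^`().[s])).
    rewrite rec ler_wpM2l ?divr_ge0 ?(ltW m_gt0)//.
    rewrite (bigD1 i)//= (bigD1 j)//= -addrA lerDl addr_ge0 ?sumr_ge0// => k _.
    exact: sumr_ge0.
  by rewrite lerD2r ler_wpM2r.
have -> : peval (V p) x = (profile x F).[1].
  apply/eqP; rewrite -eqe profileE !hmu; apply/eqP; apply: eq_integral => H _.
  by case: hF => _ ->; rewrite scale1r addrC subrK.
rewrite mulrAC -[a ^+ K * _ * c]mulrA.
apply: poly_growth => // [|s _|s sab].
- by rewrite !mulr_ge0 ?divr_ge0 ?(ltW m_gt0)// ltW.
- by apply: le_trans (low s); rewrite mulr_ge0 ?divr_ge0 ?(ltW m_gt0).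
apply: le_trans (low s); rewrite -mulrA ler_wpM2l ?divr_ge0 ?(ltW m_gt0)//.
rewrite profileE; case: hF => _ Fp.
by apply: hw => // H; rewrite Fp => // WH'; exact: pc.
Qed.

(** Squared Euclidean distance to [K], a polynomial to which [V] applies; [ball] refers to the sup
    norm. *)
Definition sqdist (K : 'rV[R]_n) : mpoly n R :=
  \sum_(k < n) (mvar k - mpolyC n (K ord0 k)) ^+ 2.

Lemma peval_sqdist (K H : 'rV[R]_n) :
  peval (sqdist K) H = \sum_(k < n) (H ord0 k - K ord0 k) ^+ 2.
Proof.
rewrite peval_sum; apply: eq_bigr => k _.
by rewrite /peval rmorphXn /= mevalB mevalC mevalXU.
Qed.

Lemma sqdist_ge0 (K H : 'rV[R]_n) : 0 <= peval (sqdist K) H.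
Proof. by rewrite peval_sqdist sumr_ge0// => k _; exact: sqr_ge0. Qed.

Lemma sqdist_far (K H : 'rV[R]_n) r : 0 < r -> ~ ball K r H ->
  r ^+ 2 <= peval (sqdist K) H.
Proof.
move=> r0; rewrite leNgt => nb.
apply/negP; rewrite peval_sqdist => h; apply: nb.
split=> // i k; rewrite ord1 /ball /= distrC ltNge; apply/negP => rk.
move: h; rewrite ltNge => /negP; apply.
rewrite (bigD1 k)//= -[leLHS]addr0 lerD ?sumr_ge0// => [|l _]; last first.
  exact: sqr_ge0.
by rewrite -[leRHS]real_normK ?num_real// lerXn2r ?nnegrE// ltW.
Qed.

(** Summing n squares suffices because 2 n <= (n + 1)^2. *)
Lemma sqdist_near (K H : 'rV[R]_n) r :
  (forall k, `|H ord0 k - K ord0 k| <= r / n.+1%:R) ->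
  peval (sqdist K) H <= r ^+ 2 / 2.
Proof.
move=> h; rewrite peval_sqdist.
apply: (@le_trans _ _ (\sum_(k < n) (r / n.+1%:R) ^+ 2)).
  apply: ler_sum => k _; rewrite -real_normK ?num_real// lerXn2r ?nnegrE//.
  exact: le_trans (normr_ge0 _) (h k).
rewrite sumr_const card_ord -[_ *+ n]mulr_natr expr_div_n -mulrA.
rewrite ler_wpM2l ?sqr_ge0//.
rewrite mulrC ler_pdivrMr ?exprn_gt0 ?ltr0n// mulrC ler_pdivlMr//.
by rewrite -natrX -!natrM ler_nat -[n.+1]addn1 sqrnD
  !(muln1, mul1n) mulnC leq_addl.
Qed.

(** If [K] were outside the support, high powers of a polynomial peaked at [K] would have integral
    at most [theta ^+ 2 ^+ N]. The mass near [H0], contracted towards [x] with ratio near [s0],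
    forces at least [k] times [eta ^+ 2 ^+ N], where [theta < eta]. *)
Lemma support_star x (i j : 'I_n) H0 (s0 : R) : (i < j)%N ->
  measure_support (mu (col_perm (tperm i j) x)) H0 -> 0 <= s0 <= 1 ->
  measure_support (mu x) (x + s0 *: (H0 - x)).
Proof.
move=> ij SH /andP[s00 s01]; apply: contrapT; set K := x + _ => nK.
have V1 := intertwining1 hV.
have [U [oU UK] hU] := representing_le hmu V1 nK.
have /nbhs_ballP[r /= r0 rU] := open_nbhs_nbhs (conj oU UK).
have [Hm _ hm] := EVT_max_rV (representing_support_nonempty hmu V1 x)
  (@mu_compact x) (continuous_subspaceT (@peval_continuous _ _ (sqdist K))).
(* [Hm] is the support point farthest from [K], so 1 - [sqdist K] / [C] is nonnegative on the
   support, and at most [theta] there off the ball of radius [r]. *)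
pose C := peval (sqdist K) Hm + r ^+ 2.
have rC : r ^+ 2 <= C by rewrite lerDr sqdist_ge0.
have C0 : 0 < C by rewrite (lt_le_trans _ rC)// exprn_gt0.
pose theta := 1 - r ^+ 2 / C; pose eta := 1 - r ^+ 2 / 2 / C.
have theta0 : 0 <= theta by rewrite subr_ge0 ler_pdivrMr// mul1r.
have theta_eta : theta < eta.
  rewrite ltrD2l ltrN2 ltr_pM2r ?invr_gt0// ltr_pdivrMr// mulr_natr mulr2n.
  by rewrite ltrDl exprn_gt0.
pose p N := (mpolyC n 1 - C^-1 *: sqdist K) ^+ 2 ^+ N.
have pE N H : peval (p N) H = (1 - peval (sqdist K) H / C) ^+ 2 ^+ N.
  by rewrite /peval !rmorphXn /= mevalB mevalC mevalZ [C^-1 * _]mulrC.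
have p0 N H : 0 <= peval (p N) H by rewrite pE exprn_ge0// sqr_ge0.
have up N : peval (V (p N)) x <= theta ^+ 2 ^+ N.
  apply: hU => [//||H SxH nU]; first by rewrite exprn_ge0// sqr_ge0.
  rewrite pE lerXn2r ?nnegrE ?sqr_ge0// lerXn2r ?nnegrE//.
    rewrite subr_ge0 ler_pdivrMr// mul1r (le_trans (hm H (mem_set SxH)))//.
    by rewrite lerDl sqr_ge0.
  rewrite lerD2l lerN2 ler_wpM2r ?invr_ge0 ?(ltW C0)//.
  by apply: sqdist_far => // /rU.
pose D := 1 + \sum_(k < n) `|H0 ord0 k - x ord0 k|.
have D0 : 0 < D by rewrite ltr_pwDl// sumr_ge0.
pose rho := r / n.+1%:R; have rho0 : 0 < rho by rewrite divr_gt0.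
pose e := Num.min 1 (rho / D).
have e0 : 0 < e by rewrite lt_min ltr01 divr_gt0.
have e1 : e <= 1 by rewrite ge_min lexx.
have eD : e * D <= rho by rewrite -ler_pdivlMr// ge_min lexx orbT.
(* A nondegenerate interval inside (0, 1] and within [e] of [s0], even when [s0] is 0 or 1. *)
pose a := (1 - e) * s0 + e / 2; pose b := (1 - e) * s0 + e.
have es0 : 0 <= (1 - e) * s0 by rewrite mulr_ge0// subr_ge0.
have es1 : 0 <= (1 - e) * (1 - s0) by rewrite mulr_ge0// subr_ge0.
have es2 : 0 <= e * s0 by rewrite mulr_ge0// ltW.
have es3 : 0 <= e * (1 - s0) by rewrite mulr_ge0 ?subr_ge0// ltW.
have a0 : 0 < a by rewrite /a; lra.
have ab : a < b by rewrite /a /b; lra.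
have b1 : b <= 1 by rewrite /b; lra.
have oW : open (ball H0 e) by exact: ball_open.
have [k k0 low] := star_lower_bound ij SH oW (ballxx H0 e0) a0 ab b1.
have eta0 : 0 <= eta by rewrite (le_trans theta0)// ltW.
have te2 : theta ^+ 2 < eta ^+ 2 by rewrite ltr_sqr.
have [N] := exp_beats k0 (sqr_ge0 _) te2.
rewrite ltNge => /negP; apply; apply: le_trans (up N).
apply: low => [//||s H /andP[sa sb] [_ HH]].
  by rewrite exprn_ge0// sqr_ge0.
suff hn : peval (sqdist K) (x + s *: (H - x)) <= r ^+ 2 / 2.
  have hn' : eta <= 1 - peval (sqdist K) (x + s *: (H - x)) / C.
    by rewrite lerD2l lerN2 ler_wpM2r// invr_ge0 ltW.
  by rewrite pE !lerXn2r ?nnegrE ?sqr_ge0// (le_trans eta0).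
apply: sqdist_near => l; rewrite !mxE -/rho.
have s_le1 : s <= 1 by exact: le_trans sb b1.
have s_ge0 : 0 <= s by rewrite (le_trans (ltW a0)).
have ss0 : `|s - s0| <= e by rewrite ler_norml; move: sa sb; rewrite /a /b; lra.
have Hl := HH ord0 l; rewrite /ball /= distrC in Hl.
have dl : `|H0 ord0 l - x ord0 l| <= D - 1.
  by rewrite /D [leRHS]addrC addKr (bigD1 l)//= lerDl sumr_ge0.
(* The two errors, from [H] and from [s], are at most [e] and e (D - 1); this is why [e] was chosen
   with [e * D <= rho]. *)
have -> : x ord0 l + s * (H ord0 l - x ord0 l) -
    (x ord0 l + s0 * (H0 ord0 l - x ord0 l)) =
    s * (H ord0 l - H0 ord0 l) + (s - s0) * (H0 ord0 l - x ord0 l) by ring.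
apply: le_trans eD; apply: le_trans (ler_normD _ _) _; rewrite !normrM.
have -> : e * D = 1 * e + e * (D - 1) by ring.
apply: lerD; apply: ler_pM => //; last exact: ltW.
by rewrite ger0_norm.
Qed.

End Star.

(** The target point is reached by contracting [H] first towards [d], with ratio s / b, and then
    towards [c], with ratio b. *)
Lemma star_kernel_convex {R : realType} {n : nat} (S : set 'rV[R]_n) :
  @convex_set R 'rV[R]_n
    [set c | forall H (s : R), S H -> 0 <= s <= 1 -> S (c + s *: (H - c))].
Proof.
apply/convex_setP => c d a /andP[a0 a1] cS dS H s SH /andP[s0 s1].
(* Chosen so that [c] gets weight 1 - b = a (1 - s) and [d] gets b - s = (1 - a) (1 - s). *)
pose b := 1 - a + a * s.
have as0 : 0 <= a * s by exact: mulr_ge0.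
have as1 : 0 <= a * (1 - s) by rewrite mulr_ge0 ?subr_ge0.
have b01 : 0 <= b <= 1 by apply/andP; split; rewrite /b; lra.
have [b0|bn0] := eqVneq b 0.
  have [-> ->] : a = 1 /\ s = 0.
    have a_1 : a = 1 by move: b0; rewrite /b; lra.
    by split=> //; move: b0; rewrite /b a_1; lra.
  rewrite subrr scale1r !scale0r !addr0.
  by have := cS H 0 SH; rewrite scale0r addr0 lexx ler01; apply.
have b_gt0 : 0 < b by rewrite lt_neqAle eq_sym bn0; case/andP: b01.
have t01 : 0 <= s / b <= 1.
  rewrite divr_ge0 ?(ltW b_gt0)//= ler_pdivrMr// mul1r /b.
  by have : 0 <= (1 - a) * (1 - s); [rewrite mulr_ge0// subr_ge0 | lra].
have := cS _ b (dS H (s / b) SH t01) b01.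
congr (S _); apply/rowP => k; rewrite !mxE.
by rewrite /b; field.
Qed.

(** * From transpositions to the whole orbit and its hull *)

Section Lower.
Context {R : realType} {n : nat} (m : R).
Hypothesis n_ge2 : (2 <= n)%N.
Hypothesis m_gt0 : 0 < m.
Context (V : {linear mpoly n R -> mpoly n R}).
Hypothesis hV : dunkl_intertwining m V.
Context (mu : 'rV[R]_n -> {measure set (borel_rV R n) -> \bar R}).
Hypothesis mu_compact : forall X, compact (measure_support (mu X)).
Hypothesis hmu : forall (p : mpoly n R) (X : 'rV[R]_n),
  (peval (V p) X)%:E = (\int[mu X]_(H in setT) (peval p H)%:E)%E.
Implicit Types (x H : 'rV[R]_n).

Lemma support_star_tperm x (i j : 'I_n) H s : i != j ->
  measure_support (mu (col_perm (tperm i j) x)) H -> 0 <= s <= 1 ->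
  measure_support (mu x) (x + s *: (H - x)).
Proof.
rewrite neq_ltn => /orP[ij|ji].
  exact: (support_star m_gt0 hV mu_compact hmu ij).
by rewrite tpermC; exact: (support_star m_gt0 hV mu_compact hmu ji).
Qed.

(** The endpoint s = 1 of the segments gives the inclusion for a transposition; [t] is a product of
    these. *)
Lemma support_col_perm_sub x (t : 'S_n) :
  measure_support (mu (col_perm t x)) `<=` measure_support (mu x).
Proof.
have [ts -> dts] := prod_tpermP t.
elim: ts dts x => [_|[i j] ts IH /andP[ij dts]] x.
  by rewrite big_nil col_perm1.
rewrite big_cons col_permM => H SH; apply: (IH dts).
have := support_star_tperm ij SH (s := 1).
by rewrite ler01 lexx scale1r addrC subrK; exact.
Qed.

Lemma support_col_perm x (t : 'S_n) :
  measure_support (mu (col_perm t x)) = measure_support (mu x).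
Proof.
apply/seteqP; split; first exact: support_col_perm_sub.
have := @support_col_perm_sub (col_perm t x) t^-1%g.
by rewrite -col_permM mulVg col_perm1.
Qed.

Lemma hull_sub_support x : orbit_hull x `<=` measure_support (mu x).
Proof.
move=> y hy; have V1 := intertwining1 hV.
have [H SH] := representing_support_nonempty hmu V1 x.
(* A star centre lies in a nonempty set: take s = 0. *)
suff /(_ y hy H 0 SH) : orbit_hull x `<=` [set c | forall H (s : R),
    measure_support (mu x) H -> 0 <= s <= 1 ->
    measure_support (mu x) (c + s *: (H - c))].
  by rewrite scale0r addr0 lexx ler01; exact.
apply: smallest_sub; first exact: star_kernel_convex.
move=> _ [t _ <-] G s SG s01; rewrite -(support_col_perm x t).
(* One transposition suffices, since all orbit points share the same support. *)
pose i0 : 'I_n := Ordinal (ltnW n_ge2); pose i1 : 'I_n := Ordinal n_ge2.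
apply: (@support_star_tperm _ i0 i1) => //.
by rewrite !support_col_perm.
Qed.

End Lower.

Theorem corollary4p2 (R : realType) (n : nat) (hn : (2 <= n)%N)
    (m : R) (hm : 0 < m)
    (V : {linear mpoly n R -> mpoly n R}) (hV : dunkl_intertwining m V)
    (mu : 'rV[R]_n -> {measure set (borel_rV R n) -> \bar R})
    (hmu_compact : forall X : 'rV[R]_n, compact (measure_support (mu X)))
    (hmu : forall (p : mpoly n R) (X : 'rV[R]_n),
       (peval (V p) X)%:E = (\int[mu X]_(H in setT) (peval p H)%:E)%E) :
  forall X : 'rV[R]_n, measure_support (mu X) = orbit_hull X.
Proof.
move=> X; apply/seteqP; split; first exact: (support_sub_hull (ltW hm) hV hmu).
exact: (hull_sub_support hn hm hV hmu_compact hmu).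
Qed.
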